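(* For any virtual twist knot $K$ (that is, any virtual knot represented by a diagram $VT(a_1,\dots,a_n)$ with $n\ge1$ and $a_1,\dots,a_n$ integers), $$2\,\bigl|\overline{\Delta}_0(K)(-1,-1)\bigr| = \bigl|OW(K)\bigr|,$$ where $OW(K)$ denotes the odd writhe of $K$.
   Context: Virtual knots are equivalence classes of oriented virtual knot diagrams (diagrams with classical and virtual crossings) under the classical and virtual Reidemeister moves (Kauffman). Notation. For integers $a_1,\dots,a_n$: $s(0)=0$, $s(i)=\sum_{j=1}^{i}(a_j+1)$. Alexander matrix. An oriented virtual link diagram has classical crossings (with over/under information and a sign $\pm$) and virtual crossings. An arc runs from one classical crossing to the next classical crossing, ignoring virtual crossings; a diagram $D$ with $N'$ classical crossings has $2N'$ arcs, which are given a fixed order. At a classical crossing let $\omega,\omega'$ be the incoming and outgoing arcs of the over strand and $\nu,\nu'$ the incoming and outgoing arcs of the under strand. A positive crossing gives the two relations $\nu-\omega'-u\nu'+u\omega=0$ and $v\omega'-\omega=0$ (in this order); a negative crossing gives $\omega-\nu'-u\omega'+u\nu=0$ and $v\omega-\omega'=0$ (in this order). (If arcs coincide, coefficients are added.) The $2N'\times 2N'$ coefficient matrix (a consecutive pair of rows per crossing, columns indexed by the arcs in order) is the Alexander matrix, and $\Delta_0(D)(u,v)\in\mathbb{Z}[u,v]$ is its determinant. Different diagrams (and arc orders) of the same virtual knot have $\Delta_0(D)$ differing by a factor $\pm(uv)^k$. The invariant of the knot $K$ with diagram $D$ is the normalization $\Delta_0(K)(u,v)=(-1)^r(uv)^{-s}\Delta_0(D)(u,v)$,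 where $s$ is the lowest power of $u$ in $\Delta_0(D)$ and $(-1)^r$ is the sign of the term of $(uv)^{-s}\Delta_0(D)$ of lowest total degree (among ties, the one with lowest degree in $u$); it is $0$ if $\Delta_0(D)=0$. For a virtual knot, $(u-1)(v-1)(uv-1)$ divides $\Delta_0(K)$ (Silver–Williams), and $\overline{\Delta}_0(K)$ denotes the quotient: $\Delta_0(K)=(u-1)(v-1)(uv-1)\overline{\Delta}_0(K)$. Virtual twist knot diagram $VT(a_1,\dots,a_n)$, for integers $a_i$. Two strands are twisted horizontally in $n$ blocks from left to right; block $i$ has $|a_i|$ classical crossings, all with the sign of $a_i$; consecutive blocks are separated by one virtual crossing; the ends are closed up by a clasp consisting of one classical and one virtual crossing. Put $N=\sum|a_i|$. The classical crossings are $c_1$ (clasp) and $c_2,\dots,c_{N+1}$ (the twist, left to right); the ordered arcs are $x_1,\dots,x_{2N+2}$. At $c_{k+1}$ ($1\le k\le N$) the odd strand passes from $x_{2k-1}$ to $x_{2k+1}$ and the even strand passes from $x_{2k+2}$ to $x_{2k}$. If $c_{k+1}$ is the $r$-th crossing of block $i$, it is of type 1 if $s(i-1)+r-1$ is even (an even number of classical and virtual crossings precede it in the twist) and of type 2 otherwise. In positive type 1 and negative type 2 crossings the even strand is over; in negative type 1 and positive type 2 crossings the odd strand is over. At $c_1$ the over strand passes from $x_2$ to $x_1$, the under strand passes from $x_{2N+1}$ to $x_{2N+2}$, and the sign is positive if $s(n)$ is even and negative if $s(n)$ is odd. Odd writhe. A classical crossing of a virtual knot diagram is odd if the path along the knot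 from the crossing back to itself goes through an odd number of classical crossings (counted with multiplicity, not counting the crossing itself). The odd writhe $OW(K)$ is the sum of the signs of the odd classical crossings of a diagram of $K$; it is an invariant of virtual knots (Kauffman). *)

(* Defs.v *)
From HB Require Import structures.
From mathcomp Require Import all_boot all_order all_algebra.
From Stdlib Require Import Relation_Operators.

Set Implicit Arguments.
Unset Strict Implicit.
Unset Printing Implicit Defensive.
Import Order.TTheory GRing.Theory Num.Theory.
Local Open Scope ring_scope.

(* An oriented virtual link diagram is recorded by its classical crossings and
   by the way the arcs join them.  Virtual crossings carry no further data: up
   to the virtual moves, a diagram is determined by its Gauss code.
   The arcs of a diagram with N' classical crossings are x_1, ..., x_2N', and
   x_i is represented by the number i (starting from 1). *)
Record crossing := Crossing {
  positive : bool;
  over_in : nat;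
  over_out : nat;
  under_in : nat;
  under_out : nat
}.

Definition diagram := seq crossing.

Definition num_arcs (D : diagram) : nat := (2 * size D)%N.

Definition crossing0 : crossing := Crossing true 0 0 0 0.

(* Position in D of the crossing at the end of arc x. *)
Definition end_crossing (D : diagram) (x : nat) : nat :=
  find (fun c => (x == over_in c) || (x == under_in c)) D.

Definition next_arc (D : diagram) (x : nat) : nat :=
  let c := nth crossing0 D (end_crossing D x) in
  if x == over_in c then over_out c else under_out c.

(* Each arc enters one crossing and leaves one crossing, and the successive
   arcs form a single closed curve.  An arc runs from crossing to crossing, so
   there must be at least one classical crossing. *)
Definition knot_diagram (D : diagram) : bool :=
  [&& (0 < size D)%N,
      perm_eq (flatten [seq [:: over_in c; under_in c] | c <- D])
              (iota 1 (num_arcs D)),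
      perm_eq (flatten [seq [:: over_out c; under_out c] | c <- D])
              (iota 1 (num_arcs D)) &
      perm_eq (traject (next_arc D) 1%N (num_arcs D)) (iota 1 (num_arcs D))].

(* A letter (c, o, p) is a passage through the crossing labelled c, on the over
   strand if o is true and on the under strand otherwise; p tells whether the
   crossing is positive. *)
Definition letter := (nat * bool * bool)%type.
Definition code := seq letter.

Definition gauss_letter (D : diagram) (x : nat) : letter :=
  let i := end_crossing D x in
  let c := nth crossing0 D i in
  (i, x == over_in c, positive c).

Definition gauss_code (D : diagram) : code :=
  [seq gauss_letter D x | x <- traject (next_arc D) 1%N (num_arcs D)].

Definition fresh (c : nat) (w : code) : bool :=
  c \notin [seq l.1.1 | l <- w].

Definition two (b : bool) (l l' : letter) : code :=
  if b then [:: l'; l] else [:: l; l'].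

(* The segments of the top, middle and bottom strands of a third Reidemeister
   move; x is the crossing of top and middle, y of top and bottom, z of middle
   and bottom.  If the strands are those of the braid word s1 s2 s1, all
   crossings have the same sign p and the strands meet them in the orders
   (x, y), (x, z) and (y, z).  The booleans t, m, b tell which strands have the
   opposite orientation: this reverses the order along the strand and changes
   the sign of its two crossings.  The move itself reverses all three orders
   (r = true) and keeps the signs. *)
Definition top_seg (x y : nat) (p t m b r : bool) : code :=
  two (t (+) r) (x, true, p (+) t (+) m) (y, true, p (+) t (+) b).
Definition middle_seg (x z : nat) (p t m b r : bool) : code :=
  two (m (+) r) (x, false, p (+) t (+) m) (z, true, p (+) m (+) b).
Definition bottom_seg (y z : nat) (p t m b r : bool) : code :=
  two (b (+) r) (y, false, p (+) t (+) b) (z, false, p (+) m (+) b).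

(* Changes of names and of base point, and the classical Reidemeister moves
   with all their orientations.  In the second move the two strands are
   parallel if b = false and antiparallel if b = true.  The two constructors
   for the third move are the two cyclic orders in which the knot can pass
   through the three segments. *)
Inductive reidemeister : code -> code -> Prop :=
| RelabelMove (f : nat -> nat) (w : code) :
    injective f ->
    reidemeister w [seq (f l.1.1, l.1.2, l.2) | l <- w]
| RotateMove (w1 w2 : code) :
    reidemeister (w1 ++ w2) (w2 ++ w1)
| Move1 (x : nat) (o p : bool) (w : code) :
    fresh x w ->
    reidemeister w ([:: (x, o, p); (x, ~~ o, p)] ++ w)
| Move2 (x y : nat) (p b : bool) (w1 w2 : code) :
    x != y -> fresh x (w1 ++ w2) -> fresh y (w1 ++ w2) ->
    reidemeister (w1 ++ w2)
      ([:: (x, true, p); (y, true, ~~ p)] ++ w1 ++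
       two b (x, false, p) (y, false, ~~ p) ++ w2)
| Move3 (x y z : nat) (p t m b : bool) (w1 w2 w3 : code) :
    let word r := top_seg x y p t m b r ++ w1 ++ middle_seg x z p t m b r ++
                  w2 ++ bottom_seg y z p t m b r ++ w3 in
    reidemeister (word false) (word true)
| Move3' (x y z : nat) (p t m b : bool) (w1 w2 w3 : code) :
    let word r := top_seg x y p t m b r ++ w1 ++ bottom_seg y z p t m b r ++
                  w2 ++ middle_seg x z p t m b r ++ w3 in
    reidemeister (word false) (word true).

Definition same_virtual_knot (D D' : diagram) : Prop :=
  clos_refl_sym_trans code reidemeister (gauss_code D) (gauss_code D').

(* Z[u, v] is {poly {poly int}}, the coefficient of u^i v^j in p being
   p`_i`_j. *)
Definition Zuv := {poly {poly int}}.
Definition U : Zuv := 'X.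
Definition V : Zuv := 'X%:P.
Definition eval_uv (p : Zuv) (a b : int) : int := p.[a%:P].[b].

Definition arc_coef (i x : nat) : Zuv := (i == x)%:R.

Definition first_relation (c : crossing) (x : nat) : Zuv :=
  if positive c
  then arc_coef (under_in c) x - arc_coef (over_out c) x
       - U * arc_coef (under_out c) x + U * arc_coef (over_in c) x
  else arc_coef (over_in c) x - arc_coef (under_out c) x
       - U * arc_coef (over_out c) x + U * arc_coef (under_in c) x.

Definition second_relation (c : crossing) (x : nat) : Zuv :=
  if positive c
  then V * arc_coef (over_out c) x - arc_coef (over_in c) x
  else V * arc_coef (over_in c) x - arc_coef (over_out c) x.

(* The rows 2k and 2k+1 belong to the crossing at position k, the column j
   belongs to the arc x_(j+1). *)
Definition alexander_matrix (D : diagram) : 'M[Zuv]_(num_arcs D) :=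
  \matrix_(i, j)
    let c := nth crossing0 D i./2 in
    if odd i then second_relation c j.+1 else first_relation c j.+1.

Definition alexander_det (D : diagram) : Zuv := \det (alexander_matrix D).

Definition lowest_u (p : Zuv) : nat := find (fun c => c != 0) (p : seq {poly int}).

(* All coefficients of p, by increasing total degree and, within one total
   degree, by increasing degree in u. *)
Definition ordered_coefs (p : Zuv) : seq int :=
  flatten [seq [seq p`_i`_(d - i) | i <- iota 0 d.+1]
          | d <- iota 0 (size p + \max_(i < size p) size (p`_i)%R)%N].

Definition lowest_coef (p : Zuv) : int :=
  nth 0 (ordered_coefs p) (find (fun c => c != 0) (ordered_coefs p)).

(* Laurent polynomials are taken in the field of fractions of Z[u, v].  The
   normalization may have negative powers of v. *)
Definition Quv := {fraction Zuv}.

Definition Delta0 (D : diagram) : Quv :=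
  let p := alexander_det D in
  (sgz (lowest_coef p))%:~R * tofrac (U * V) ^- lowest_u p * tofrac p.

Definition Delta0bar (D : diagram) : Quv :=
  Delta0 D / tofrac ((U - 1) * (V - 1) * (U * V - 1)).

(* f is the Laurent polynomial q / (uv)^k with q in Z[u, v], and z is its value
   at u = a, v = b, where a and b are units of Z. *)
Definition laurent_value (f : Quv) (a b z : int) : Prop :=
  exists (q : Zuv) (k : nat),
    f = tofrac q / tofrac (U * V) ^+ k /\ z * (a * b) ^+ k = eval_uv q a b.

Lemma UV_neq0 : U * V != 0.
Proof. by rewrite mulf_neq0 // /V ?polyC_eq0 polyX_eq0. Qed.

Lemma eval_uvM p q a b : eval_uv (p * q) a b = eval_uv p a b * eval_uv q a b.
Proof. by rewrite /eval_uv !hornerM. Qed.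

Lemma eval_UVX k a b : eval_uv ((U * V) ^+ k) a b = (a * b) ^+ k.
Proof. by rewrite /eval_uv !horner_exp /U /V !hornerE. Qed.

Lemma laurent_value_inj f a b z z' :
  a * b != 0 -> laurent_value f a b z -> laurent_value f a b z' -> z = z'.
Proof.
move=> ab [q [k [-> zq]]] [q' [k' [qq' zq']]].
have nz n : tofrac (U * V) ^+ n != 0 by rewrite expf_neq0 ?tofrac_eq0 ?UV_neq0.
have /eqP := qq'; rewrite eqr_div ?nz // -!tofracXn -!tofracM tofrac_eq => /eqP.
move=> /(congr1 (fun p => eval_uv p a b)); rewrite !eval_uvM !eval_UVX -zq -zq'.
rewrite mulrAC => /(mulIf (expf_neq0 _ ab)) /(mulIf (expf_neq0 _ ab)) //.
Qed.

(* For the crossing at position k: the number of letters strictly between its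
   two occurrences in the Gauss code.  Both paths from the crossing back to
   itself have the same parity, as a Gauss code has even length. *)
Definition return_length (D : diagram) (k : nat) : nat :=
  let p := positive (nth crossing0 D k) in
  let i := index (k, true, p) (gauss_code D) in
  let j := index (k, false, p) (gauss_code D) in
  (maxn i j - minn i j).-1.

Definition odd_writhe (D : diagram) : int :=
  \sum_(k < size D | odd (return_length D k))
    (if positive (nth crossing0 D k) then 1 else -1).

Definition block (a : seq int) (i : nat) : int := nth 0 a i.-1.

Definition twist_s (a : seq int) (i : nat) : int :=
  \sum_(1%N <= j < i.+1) (block a j + 1).

Definition type1 (a : seq int) (i r : nat) : bool :=
  (2 %| (twist_s a i.-1 + r%:Z - 1)%R)%Z.

(* The pairs (sign is positive, type is 1) of the classical crossings of the
   twist, from left to right. *)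
Definition twist_kinds (a : seq int) : seq (bool * bool) :=
  flatten [seq [seq (0 < block a i, type1 a i r) | r <- iota 1 `|block a i|%N]
          | i <- iota 1 (size a)].

Definition twist_crossing (k : nat) (kind : bool * bool) : crossing :=
  let: (pos, t1) := kind in
  if pos == t1
  then Crossing pos (2 * k + 2) (2 * k) (2 * k - 1) (2 * k + 1)
  else Crossing pos (2 * k - 1) (2 * k + 1) (2 * k + 2) (2 * k).

Definition VT (a : seq int) : diagram :=
  let N := (\sum_(x <- a) `|x|)%N in
  Crossing (2 %| twist_s a (size a))%Z 2 1 (2 * N + 1) (2 * N + 2)
  :: [seq twist_crossing k (nth (true, true) (twist_kinds a) k.-1)
     | k <- iota 1 N].

(* Main.v *)
Require Import Defs.
From mathcomp Require Import all_boot all_order all_algebra all_fingroup.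
From mathcomp Require Import ring zify.
Import Order.TTheory GRing.Theory Num.Theory.
Local Open Scope ring_scope.
Set Implicit Arguments.
Unset Strict Implicit.
Unset Printing Implicit Defensive.

(** The identity comes from expanding the Alexander determinant to first order
    at the point (-1, -1) of the curve uv = 1, where it vanishes.  The expansion
    is read off the cyclic order of the arcs along the knot.

    Divisibility.  The Alexander matrix is singular on each of the curves u = 1,
    v = 1 and uv = 1.  At u = 1 a crossing preserves the sum of the values of
    its two strands, so the first relations add up to 0 (det_relation_u1).  At
    v = 1 constant assignments of values to the arcs solve all relations
    (det_relation_v1).  If uv = 1, passing a crossing multiplies the value of
    each strand by a factor of its own, the two factors at a crossing are
    inverse to each other, and so following the knot once around leads back to
    the initial value (det_relation_uv1).  Hence the determinant is
    (u - 1)(v - 1)(uv - 1) q with q a Laurent polynomial (uv_factor).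

    Value of the quotient.  Put u = -1 and v = e - 1.  The product of the three
    factors becomes 2e(v - 1), that is -4e to first order in e, so it is enough
    to find the coefficient of e in the determinant.  After a row operation in
    each crossing, the row of a passage from arc x to arc x' reads
    x + x' - e s up to sign, where s is one arc of the crossing, the same for
    both passages (relation_row_op).  Number the arcs along the knot and give
    the i-th row and the i-th column the sign (-1)^i: the matrix becomes
    1 - C + eB, with C the matrix of a cyclic permutation.  All cofactors of
    1 - C have the same absolute value 1, so the coefficient of e is, up to
    sign, the sum of all entries of B (det_cyclic_perturbation).  A crossing
    passed at the positions i and j contributes, up to its sign,
    1 + (-1)^(i + j) to this sum: this is 2 if an odd number of crossings is
    passed between i and j and 0 otherwise.  The sum is therefore twice the odd
    writhe (det_relation_uN1), and 4 |q(-1, -1)| = 2 |OW|. *)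

(** * Arcs and crossings of a knot diagram *)

Definition crossing_at (D : diagram) (k : nat) : crossing := nth crossing0 D k.

Definition arcs (D : diagram) : seq nat := iota 1 (num_arcs D).

Lemma flatten_crossings (D : diagram) (g h : crossing -> nat) :
  flatten [seq [:: g c; h c] | c <- D] =
  flatten [seq [:: g (crossing_at D k); h (crossing_at D k)] | k <- iota 0 (size D)].
Proof.
by rewrite -[in LHS](mkseq_nth crossing0 D) /mkseq -map_comp.
Qed.

Lemma mem_strand_ends (g h : crossing -> nat) (D : diagram) (k x : nat) :
  (k < size D)%N -> x \in [:: g (crossing_at D k); h (crossing_at D k)] ->
  x \in flatten [seq [:: g c; h c] | c <- D].
Proof.
move=> kD xk; rewrite flatten_crossings; apply/flatten_mapP.
by exists k; rewrite // mem_iota.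
Qed.

Lemma find_strand_end (g h : crossing -> nat) (D : diagram) (k x : nat) :
  uniq (flatten [seq [:: g c; h c] | c <- D]) -> (k < size D)%N ->
  x \in [:: g (crossing_at D k); h (crossing_at D k)] ->
  find (fun c => (x == g c) || (x == h c)) D = k.
Proof.
elim: D k => [|c D IH] [|k] //=; rewrite /crossing_at /=.
  by move=> _ _; rewrite !inE => ->.
move=> /and3P[gnot hnot Duniq] kD xk.
suff xD : x \in flatten [seq [:: g c; h c] | c <- D].
  have -> : (x == g c) = false.
    by apply/eqP=> xg; move: gnot; rewrite inE negb_or -xg xD andbF.
  have -> : (x == h c) = false by apply/eqP=> xh; move: hnot; rewrite -xh xD.
  by rewrite /= (IH k).
exact: mem_strand_ends xk.
Qed.

Lemma perm_in_arcs (D : diagram) : knot_diagram D ->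
  perm_eq (flatten [seq [:: over_in c; under_in c] | c <- D]) (arcs D).
Proof. by case/and4P. Qed.

Lemma perm_out_arcs (D : diagram) : knot_diagram D ->
  perm_eq (flatten [seq [:: over_out c; under_out c] | c <- D]) (arcs D).
Proof. by case/and4P. Qed.

Lemma perm_traject_arcs (D : diagram) : knot_diagram D ->
  perm_eq (traject (next_arc D) 1%N (num_arcs D)) (arcs D).
Proof. by case/and4P. Qed.

Lemma end_over_in (D : diagram) (k : nat) : knot_diagram D -> (k < size D)%N ->
  end_crossing D (over_in (crossing_at D k)) = k.
Proof.
move=> /perm_in_arcs Din kD; apply: (@find_strand_end over_in under_in) => //.
  by rewrite (perm_uniq Din) iota_uniq.
by rewrite !inE eqxx.
Qed.

Lemma end_under_in (D : diagram) (k : nat) : knot_diagram D -> (k < size D)%N ->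
  end_crossing D (under_in (crossing_at D k)) = k.
Proof.
move=> /perm_in_arcs Din kD; apply: (@find_strand_end over_in under_in) => //.
  by rewrite (perm_uniq Din) iota_uniq.
by rewrite !inE eqxx orbT.
Qed.

Lemma over_neq_under (D : diagram) (k : nat) : knot_diagram D -> (k < size D)%N ->
  (under_in (crossing_at D k) == over_in (crossing_at D k)) = false.
Proof.
move=> /perm_in_arcs Din kD; have : uniq (flatten [seq [:: over_in c; under_in c] | c <- D]).
  by rewrite (perm_uniq Din) iota_uniq.
rewrite /crossing_at; elim: D k kD {Din} => [|c D IH] [|k] //= kD /and3P[].
  by rewrite inE negb_or eq_sym => /andP[/negbTE].
by move=> _ _ /IH; apply.
Qed.

Lemma next_over_in (D : diagram) (k : nat) : knot_diagram D -> (k < size D)%N ->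
  next_arc D (over_in (crossing_at D k)) = over_out (crossing_at D k).
Proof. by move=> DK kD; rewrite /next_arc end_over_in // eqxx. Qed.

Lemma next_under_in (D : diagram) (k : nat) : knot_diagram D -> (k < size D)%N ->
  next_arc D (under_in (crossing_at D k)) = under_out (crossing_at D k).
Proof. by move=> DK kD; rewrite /next_arc end_under_in // over_neq_under. Qed.

Lemma end_crossing_lt (D : diagram) (x : nat) : knot_diagram D -> x \in arcs D ->
  (end_crossing D x < size D)%N.
Proof.
move=> DK; rewrite -(perm_mem (perm_in_arcs DK)) /end_crossing -has_find.
elim: D {DK} => //= c D IH; rewrite !inE.
by case: eqP => //= _; case: eqP => //= _; apply: IH.
Qed.

Lemma arc_end_strand (D : diagram) (x : nat) : knot_diagram D -> x \in arcs D ->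
  let c := crossing_at D (end_crossing D x) in
  x = if x == over_in c then over_in c else under_in c.
Proof.
move=> DK /(end_crossing_lt DK); rewrite /end_crossing -has_find => H.
have := nth_find crossing0 H; rewrite -/(crossing_at D _) -/(end_crossing D x) /=.
by case: eqP => //= _ /eqP.
Qed.

Lemma big_in_arcs (D : diagram) (T : Type) (idx : T) (op : Monoid.com_law idx)
    (F : nat -> T) : knot_diagram D ->
  \big[op/idx]_(x <- arcs D) F x =
  \big[op/idx]_(k < size D) op (F (over_in (crossing_at D k))) (F (under_in (crossing_at D k))).
Proof.
move=> /perm_in_arcs /(perm_big _) <-; rewrite big_flatten big_map (big_nth crossing0) big_mkord.
by apply: eq_bigr => k _; rewrite !big_cons big_nil Monoid.mulm1.
Qed.

Lemma big_out_arcs (D : diagram) (T : Type) (idx : T) (op : Monoid.com_law idx)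
    (F : nat -> T) : knot_diagram D ->
  \big[op/idx]_(x <- arcs D) F x =
  \big[op/idx]_(k < size D) op (F (over_out (crossing_at D k))) (F (under_out (crossing_at D k))).
Proof.
move=> /perm_out_arcs /(perm_big _) <-; rewrite big_flatten big_map (big_nth crossing0) big_mkord.
by apply: eq_bigr => k _; rewrite !big_cons big_nil Monoid.mulm1.
Qed.

Lemma crossing_arcs (D : diagram) (k : nat) : knot_diagram D -> (k < size D)%N ->
  [/\ over_in (crossing_at D k) \in arcs D, under_in (crossing_at D k) \in arcs D,
      over_out (crossing_at D k) \in arcs D & under_out (crossing_at D k) \in arcs D].
Proof.
move=> DK kD; split.
- by rewrite -(perm_mem (perm_in_arcs DK)) (mem_strand_ends kD) // !inE eqxx.
- by rewrite -(perm_mem (perm_in_arcs DK)) (mem_strand_ends kD) // !inE eqxx orbT.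
- by rewrite -(perm_mem (perm_out_arcs DK)) (mem_strand_ends kD) // !inE eqxx.
- by rewrite -(perm_mem (perm_out_arcs DK)) (mem_strand_ends kD) // !inE eqxx orbT.
Qed.

Lemma num_arcs_gt0 (D : diagram) : knot_diagram D -> (0 < num_arcs D)%N.
Proof. by case/and4P; rewrite /num_arcs; lia. Qed.

(** * Positions of the arcs along the knot *)

Definition arc_at (D : diagram) (i : nat) : nat := iter i (next_arc D) 1%N.

Definition arc_pos (D : diagram) (x : nat) : nat :=
  index x (traject (next_arc D) 1%N (num_arcs D)).

Lemma uniq_traject (D : diagram) : knot_diagram D ->
  uniq (traject (next_arc D) 1%N (num_arcs D)).
Proof. by move=> /perm_traject_arcs Dt; rewrite (perm_uniq Dt) iota_uniq. Qed.

Lemma arc_posK (D : diagram) (i : nat) : knot_diagram D -> (i < num_arcs D)%N ->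
  arc_pos D (arc_at D i) = i.
Proof.
move=> DK im; rewrite /arc_pos /arc_at -(nth_traject _ im).
by rewrite index_uniq ?size_traject ?uniq_traject.
Qed.

Lemma arc_atK (D : diagram) (x : nat) : knot_diagram D -> x \in arcs D ->
  arc_at D (arc_pos D x) = x.
Proof.
move=> DK; rewrite -(perm_mem (perm_traject_arcs DK)) => xt.
have := xt; rewrite -index_mem size_traject => lt.
by rewrite /arc_at -(nth_traject _ lt) nth_index.
Qed.

Lemma arc_pos_lt (D : diagram) (x : nat) : knot_diagram D -> x \in arcs D ->
  (arc_pos D x < num_arcs D)%N.
Proof.
by move=> DK; rewrite -(perm_mem (perm_traject_arcs DK)) -index_mem size_traject.
Qed.

Lemma arc_at_arcs (D : diagram) (i : nat) : knot_diagram D -> (i < num_arcs D)%N ->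
  arc_at D i \in arcs D.
Proof.
move=> DK im; rewrite -(perm_mem (perm_traject_arcs DK)) /arc_at -(nth_traject _ im).
by rewrite mem_nth ?size_traject.
Qed.

Lemma map_next_arc (D : diagram) : knot_diagram D ->
  perm_eq (map (next_arc D) (arcs D)) (arcs D).
Proof.
move=> DK; rewrite -(permPr (perm_out_arcs DK)).
rewrite -(permPl (perm_map (next_arc D) (perm_in_arcs DK))) !flatten_crossings.
rewrite map_flatten -map_comp.
suff -> : map (map (next_arc D) \o
      (fun k => [:: over_in (crossing_at D k); under_in (crossing_at D k)])) (iota 0 (size D)) =
   [seq [:: over_out (crossing_at D k); under_out (crossing_at D k)] | k <- iota 0 (size D)] by [].
apply/eq_in_map => k; rewrite mem_iota => /= kD.
by rewrite next_over_in // next_under_in.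
Qed.

Lemma map_traject (T : Type) (f : T -> T) (x : T) (n : nat) :
  map f (traject f x n) = traject f (f x) n.
Proof. by elim: n x => //= n IH x; rewrite IH. Qed.

(** As next_arc permutes the arcs, applying it to the list of all arcs in the order
    of the traversal permutes the list; but it also shifts the list, so the arc
    entering at the end is the one dropped at the beginning. *)
Lemma arc_at_closed (D : diagram) : knot_diagram D -> arc_at D (num_arcs D) = 1%N.
Proof.
move=> DK; have : (0 < num_arcs D)%N by case/and4P: DK; rewrite /num_arcs; lia.
have : perm_eq (map (next_arc D) (traject (next_arc D) 1%N (num_arcs D)))
               (traject (next_arc D) 1%N (num_arcs D)).
  rewrite (permPl (perm_map _ (perm_traject_arcs DK))) (permPr (perm_traject_arcs DK)).
  exact: map_next_arc.
rewrite map_traject /arc_at; case: (num_arcs D) => // m.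
rewrite trajectSr trajectS -iterSr perm_rcons => + _.
set y := iter _ _ _; set s := traject _ _ _ => ys.
have : perm_eq ([:: y] ++ s) ([:: 1%N] ++ s) by [].
by rewrite perm_cat2r => /perm_small_eq => /(_ isT) [].
Qed.

Lemma next_arc_at (D : diagram) (i : nat) : next_arc D (arc_at D i) = arc_at D i.+1.
Proof. by []. Qed.

Lemma big_arcs_at (D : diagram) (T : Type) (idx : T) (op : Monoid.com_law idx)
    (F : nat -> T) : knot_diagram D ->
  \big[op/idx]_(x <- arcs D) F x = \big[op/idx]_(i < num_arcs D) F (arc_at D i).
Proof.
move=> DK; rewrite -(perm_big _ (perm_traject_arcs DK)) (big_nth 1%N) size_traject big_mkord.
by apply: eq_bigr => i _; rewrite nth_traject.
Qed.

(** The signs alternate all the way around the knot, also from the last arc to the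
    first, because the number of arcs is even. *)
Lemma sign_next_arc (R : comNzRingType) (D : diagram) (x : nat) :
  knot_diagram D -> x \in arcs D ->
  (-1) ^+ arc_pos D (next_arc D x) = - (-1) ^+ arc_pos D x :> R.
Proof.
move=> DK xD; rewrite -{1}(arc_atK DK xD) next_arc_at.
have := arc_pos_lt DK xD; rewrite leq_eqVlt => /orP[/eqP im|im].
  rewrite im arc_at_closed // -[1%N]/(arc_at D 0) arc_posK ?num_arcs_gt0 //.
  suff odd_last : odd (arc_pos D x) by rewrite -[in RHS]signr_odd odd_last opprK.
  by move: im; rewrite /num_arcs; lia.
by rewrite arc_posK // exprS mulN1r.
Qed.

(** The potential at an arc is the product of the weights met on the way from the
    first arc; the hypothesis makes it single-valued. *)
Lemma knot_potential (R : comNzRingType) (D : diagram) (w : nat -> R) :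
  knot_diagram D -> \prod_(x <- arcs D) w x = 1 ->
  exists y : nat -> R, y 1%N = 1 /\
    forall x, x \in arcs D -> y (next_arc D x) = w x * y x.
Proof.
move=> DK w1; pose y x : R := \prod_(i < arc_pos D x) w (arc_at D i).
have y1 : y 1%N = 1.
  by rewrite /y -[1%N]/(arc_at D 0) arc_posK ?num_arcs_gt0 // big_ord0.
exists y; split=> // x xD; rewrite -{1 2}(arc_atK DK xD) next_arc_at.
have := arc_pos_lt DK xD; rewrite leq_eqVlt => /orP[/eqP im|im].
  rewrite im arc_at_closed // y1 -w1 (big_arcs_at _ _ DK) -im big_ord_recr /=.
  by rewrite mulrC arc_atK.
by rewrite {1}/y arc_posK // big_ord_recr mulrC.
Qed.

(** * Return lengths in terms of positions *)

Lemma gauss_letter_inj (D : diagram) : knot_diagram D ->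
  {in arcs D &, injective (gauss_letter D)}.
Proof.
move=> DK x y xD yD [e1 e2 _].
by rewrite (arc_end_strand DK xD) (arc_end_strand DK yD) /crossing_at e2 e1.
Qed.

Lemma index_gauss_code (D : diagram) (x : nat) : knot_diagram D -> x \in arcs D ->
  index (gauss_letter D x) (gauss_code D) = arc_pos D x.
Proof.
move=> DK xD; have xm := arc_pos_lt DK xD.
have := nth_traject (next_arc D) xm 1%N; rewrite -/(arc_at D _) arc_atK // => ex.
rewrite /gauss_code -{1}ex -(nth_map _ (gauss_letter D x)) ?size_traject //.
rewrite index_uniq ?size_map ?size_traject //.
rewrite map_inj_in_uniq ?uniq_traject // => a b.
by rewrite !(perm_mem (perm_traject_arcs DK)); apply: gauss_letter_inj.
Qed.

Lemma odd_return_length (D : diagram) (k : nat) : knot_diagram D -> (k < size D)%N ->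
  odd (return_length D k) =
  ~~ odd (arc_pos D (over_in (crossing_at D k)) + arc_pos D (under_in (crossing_at D k))).
Proof.
move=> DK kD; have [oi ui _ _] := crossing_arcs DK kD.
rewrite /return_length -/(crossing_at D k).
have <- : gauss_letter D (over_in (crossing_at D k)) = (k, true, positive (crossing_at D k)).
  by rewrite /gauss_letter end_over_in // eqxx.
have <- : gauss_letter D (under_in (crossing_at D k)) = (k, false, positive (crossing_at D k)).
  by rewrite /gauss_letter end_under_in // over_neq_under.
rewrite !index_gauss_code //.
have : arc_pos D (under_in (crossing_at D k)) <> arc_pos D (over_in (crossing_at D k)).
  move=> e; have := over_neq_under DK kD.
  by rewrite -(arc_atK DK ui) e arc_atK // eqxx.
lia.
Qed.

(** * Determinants *)

Lemma det_signed_reindex (R : comNzRingType) (m : nat) (A : 'M[R]_m)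
    (f g : 'I_m -> 'I_m) (a b : 'I_m -> nat) :
  injective f -> injective g ->
  exists e : nat,
    \det (\matrix_(i, j) ((-1) ^+ a i * (-1) ^+ b j * A (f i) (g j))) =
    (-1) ^+ e * \det A.
Proof.
move=> injf injg.
exists (\sum_i a i + (perm injf + (\sum_i b i + perm injg)))%N.
have -> : \matrix_(i, j) ((-1) ^+ a i * (-1) ^+ b j * A (f i) (g j)) =
    diag_mx (\row_i (-1) ^+ a i) *m (row_perm (perm injf) (col_perm (perm injg) A)
      *m diag_mx (\row_j (-1) ^+ b j)).
  apply/matrixP=> i j; rewrite mul_diag_mx mul_mx_diag !mxE !permE.
  by rewrite -mulrA; congr (_ * _); rewrite mulrC.
rewrite !det_mulmx !det_diag row_permE col_permE !det_mulmx !det_perm.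
under eq_bigr do rewrite mxE.
under [X in _ * (_ * X) = _]eq_bigr do rewrite mxE.
rewrite !prodrXr odd_permV; move: (\sum_i a i)%N (\sum_i b i)%N => sa sb.
move: (odd_perm _) (odd_perm _) (\det A) => pf pg d.
by rewrite !exprD -!mulrA; congr (_ * (_ * _)); rewrite mulrC -mulrA mulrCA.
Qed.

Lemma det_right_null (R : idomainType) (m : nat) (A : 'M[R]_m) (y : 'cV[R]_m) (i : 'I_m) :
  A *m y = 0 -> y i 0 != 0 -> \det A = 0.
Proof.
move=> Ay yi; have := congr1 (mulmx (\adj A)) Ay.
rewrite mulmxA mul_adj_mx mulmx0 mul_scalar_mx => /matrixP/(_ i 0).
by rewrite !mxE => /eqP; rewrite mulf_eq0 (negbTE yi) orbF => /eqP.
Qed.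

Lemma det_left_null (R : idomainType) (m : nat) (A : 'M[R]_m) (y : 'rV[R]_m) (i : 'I_m) :
  y *m A = 0 -> y 0 i != 0 -> \det A = 0.
Proof.
move=> yA yi; rewrite -det_tr; apply: (@det_right_null _ _ _ (y^T) i).
  by rewrite -trmx_mul yA trmx0.
by rewrite mxE.
Qed.

Lemma sum_delta (R : comNzRingType) (m : nat) (k : nat) (F : 'I_m -> R) (km : (k < m)%N) :
  \sum_(i < m) F i * (k == i)%N%:R = F (Ordinal km).
Proof.
rewrite (bigD1 (Ordinal km)) //= eqxx mulr1 big1 ?addr0 // => i /negbTE ik.
have -> : (k == i) = false by apply/eqP => e; move/eqP: ik; apply; apply: val_inj.
by rewrite mulr0.
Qed.

Lemma sum_delta1 (R : comNzRingType) (m : nat) (k : nat) (km : (k < m)%N) :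
  \sum_(i < m) (k == i)%N%:R = 1 :> R.
Proof.
by rewrite -[RHS](sum_delta (fun=> 1) km); apply: eq_bigr => i _; rewrite mul1r.
Qed.

Definition cyclic_diff (R : comNzRingType) (m : nat) : 'M[R]_m.+1 :=
  \matrix_(i, j) ((i == j)%:R - (i.+1 %% m.+1 == j)%N%:R).

Definition lower_ones (R : comNzRingType) (m : nat) : 'M[R]_m.+1 :=
  \matrix_(i, j) (j <= i)%N%:R.

Definition first_col_ones (R : comNzRingType) (m : nat) : 'M[R]_m.+1 :=
  \matrix_(i, j) ((i == j) || (j == ord0))%:R.

Lemma det_lower_ones (R : comNzRingType) m : \det (lower_ones R m) = 1.
Proof.
rewrite det_trig; last by apply/is_trig_mxP => i j ij; rewrite mxE leqNgt ij.
by rewrite big1 // => i _; rewrite mxE leqnn.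
Qed.

Lemma det_first_col_ones (R : comNzRingType) m : \det (first_col_ones R m) = 1.
Proof.
rewrite det_trig; last first.
  apply/is_trig_mxP => i j ij; rewrite mxE -!val_eqE /= ltn_eqF //=.
  by case: (j : nat) ij.
by rewrite big1 // => i _; rewrite mxE eqxx.
Qed.

Lemma mul_first_col (R : comNzRingType) m (A : 'M[R]_m.+1) i j :
  (A *m first_col_ones R m) i j = if j == ord0 then \sum_k A i k else A i j.
Proof.
rewrite mxE; case: eqVneq => [->|/negbTE j0].
  by apply: eq_bigr => k _; rewrite mxE eqxx orbT mulr1.
rewrite (bigD1 j) //= mxE eqxx mulr1 big1 ?addr0 // => k /negbTE kj.
by rewrite mxE kj j0 mulr0.
Qed.

(** Taking partial sums of the rows and replacing the first column by the sum of
    all columns turns 1 - C into minus the shift matrix, whose last row and first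
    column are 0. *)
Lemma lower_cyclic_first (R : comNzRingType) m (i j : 'I_m.+1) :
  (lower_ones R m *m (cyclic_diff R m *m first_col_ones R m)) i j =
  - (i.+1 == j)%N%:R.
Proof.
have CR k : (cyclic_diff R m *m first_col_ones R m) k j =
   if j == ord0 then 0 else (k == j)%N%:R - (k.+1 == j)%N%:R.
  rewrite mul_first_col; case: eqVneq => [_|j0].
    have km : (k.+1 %% m.+1 < m.+1)%N by rewrite ltn_mod.
    under eq_bigr do rewrite mxE.
    by rewrite sumrB (sum_delta1 R (ltn_ord k)) (sum_delta1 R km) subrr.
  rewrite mxE; congr (_ - _%:R); rewrite (_ : (_ == _) = (k.+1 == j)%N) //.
  have := ltn_ord k; rewrite ltnS leq_eqVlt => /orP[/eqP ->|km].
    rewrite modnn; have := ltn_ord j; rewrite -val_eqE /= in j0; lia.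
  by rewrite modn_small.
rewrite mxE; under eq_bigr do rewrite CR.
case: eqVneq => [->|j0].
  by rewrite big1 ?oppr0 // => k _; rewrite mulr0.
rewrite -val_eqE /= in j0.
under eq_bigr do rewrite mulrBr mxE.
rewrite sumrB.
have e1 := sum_delta (fun k : 'I_m.+1 => (k <= i)%N%:R : R) (ltn_ord j).
under eq_bigr do rewrite eq_sym.
rewrite e1 /=.
have jm : (j.-1 < m.+1)%N by have := ltn_ord j; lia.
under eq_bigr => k _. 
  rewrite (_ : (k.+1 == j) = (j.-1 == k)); last lia.
over.
rewrite (sum_delta (fun k : 'I_m.+1 => (k <= i)%N%:R : R) jm) /=.
have [ij|ij] := eqVneq i.+1 (j : nat).
  rewrite (_ : (j <= i)%N = false); last by lia.
  rewrite (_ : (_ <= i)%N = true) ?sub0r //; lia.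
rewrite (_ : (j <= i)%N = (j.-1 <= i)%N) ?subrr ?oppr0 //; lia.
Qed.

(** All rows of 1 - C add up to 0, and so do all columns.  Once the last row is
    replaced by the sum of all rows, it is divisible by e; dividing by e and then
    setting e = 0, the only entry left in the first column (by now the sum of all
    columns) is the sum of the entries of B, in the last row, and its cofactor is
    the determinant of a scalar matrix 1 or -1. *)
Lemma det_cyclic_perturbation (R S : comNzRingType) (phi : {rmorphism R -> S})
    (m : nat) (B : 'M[R]_m.+1) (e : R) : phi e = 0 ->
  exists (d : R) (b : nat), \det (cyclic_diff R m + e *: B) = e * d /\
    phi d = (-1) ^+ b * phi (\sum_i \sum_j B i j).
Proof.
move=> phie.
move CE: (lower_ones R m *m (B *m first_col_ones R m)) => C.
(* X is the matrix after both operations, with its last row divided by e. *)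
pose X : 'M[R]_m.+1 :=
  \matrix_(i, j) if i == ord_max then C i j else - (i.+1 == j)%N%:R + e * C i j.
exists (\det X), (m + m)%N; split.
  pose D := diag_mx (\row_(i < m.+1) if i == ord_max then e else 1).
  have detD : \det D = e.
    rewrite det_diag (bigD1 ord_max) //= mxE eqxx big1 ?mulr1 // => i /negbTE im.
    by rewrite mxE im.
  have <- : \det (lower_ones R m *m ((cyclic_diff R m + e *: B) *m first_col_ones R m)) =
            \det (cyclic_diff R m + e *: B).
    by rewrite !det_mulmx det_lower_ones det_first_col_ones mul1r mulr1.
  rewrite -[in RHS]detD -det_mulmx; congr (\det _); apply/matrixP => i j.
  rewrite mulmxDl mulmxDr -scalemxAl -scalemxAr CE mxE lower_cyclic_first.
  rewrite mul_diag_mx !mxE.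
  case: (eqVneq i ord_max) => [->|_] /=; last by rewrite mul1r.
  by rewrite gtn_eqF ?ltn_ord // oppr0 add0r.
rewrite -det_map_mx (expand_det_col _ ord0) (bigD1 ord_max) //= big1 => [|i /negbTE im].
  rewrite addr0 !mxE eqxx /cofactor addn0 -CE mxE.
  have -> : row' ord_max (col' ord0 (map_mx phi X)) = (-1)%:M.
    apply/matrixP => i j; rewrite !mxE.
    have -> : (lift ord_max i == ord_max) = false.
      by rewrite eq_sym (negbTE (neq_lift _ _)).
    rewrite rmorphD rmorphM phie mul0r addr0 lift_max lift0 eqSS rmorphN rmorph_nat.
    by rewrite -val_eqE mulNrn.
  rewrite det_scalar -exprD mulrC; congr (_ * phi _).
  by apply: eq_bigr => k _; rewrite mxE leq_ord mul1r mul_first_col eqxx.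
by rewrite !mxE im rmorphD rmorphM phie mul0r addr0 oppr0 rmorph0 mul0r.
Qed.

Lemma det_cyclic_form (R S : comNzRingType) (phi : {rmorphism R -> S})
    (m : nat) (N B : 'M[R]_m) (e : R) : (0 < m)%N -> phi e = 0 ->
  (forall i j, N i j = (i == j)%:R - (i.+1 %% m == j)%N%:R + e * B i j) ->
  exists (d : R) (b : nat), \det N = e * d /\
    phi d = (-1) ^+ b * phi (\sum_i \sum_j B i j).
Proof.
case: m N B => // m N B _ phie NE.
suff -> : N = cyclic_diff R m + e *: B by apply: det_cyclic_perturbation.
by apply/matrixP => i j; rewrite NE !mxE.
Qed.

Definition pair_row_op (R : comNzRingType) (m : nat) (t : nat -> R) : 'M[R]_m :=
  \matrix_(i, j) ((i == j)%:R + (~~ odd i && (i.+1 == j))%:R * t i).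

Lemma det_pair_row_op (R : comNzRingType) (m : nat) (t : nat -> R) :
  \det (pair_row_op m t) = 1.
Proof.
rewrite -det_tr det_trig; last first.
  apply/is_trig_mxP => i j ij; rewrite !mxE -val_eqE /= gtn_eqF //.
  by rewrite (_ : (j.+1 == i)%N = false) ?andbF ?mul0r ?addr0 //; lia.
rewrite big1 // => i _.
by rewrite !mxE eqxx (_ : (i.+1 == i)%N = false) ?andbF ?mul0r ?addr0 //; lia.
Qed.

(** * The Alexander matrix over a ring with chosen values of u and v *)

(** The argument y assigns a value to every arc.  The indicator functions of the
    arcs give the entries of the Alexander matrix. *)
Definition relation (R : comNzRingType) (u v : R) (second : bool) (c : crossing)
    (y : nat -> R) : R :=
  if second then
    if positive c then v * y (over_out c) - y (over_in c)
    else v * y (over_in c) - y (over_out c)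
  else
    if positive c
    then y (under_in c) - y (over_out c) - u * y (under_out c) + u * y (over_in c)
    else y (over_in c) - y (under_out c) - u * y (over_out c) + u * y (under_in c).

Definition relation_matrix (R : comNzRingType) (u v : R) (D : diagram) :
    'M[R]_(num_arcs D) :=
  \matrix_(i, j) relation u v (odd i) (crossing_at D i./2) (fun x => (x == j.+1)%:R).

Lemma alexander_det_eval (R : comNzRingType) (phi : {rmorphism Zuv -> R}) (D : diagram) :
  phi (alexander_det D) = \det (relation_matrix (phi U) (phi V) D).
Proof.
rewrite /alexander_det -det_map_mx; congr (\det _); apply/matrixP => i j.
rewrite !mxE /relation /first_relation /second_relation /arc_coef /crossing_at.
by case: (odd i); case: (positive _);
  rewrite ?(rmorphD, rmorphB, rmorphN, rmorphM, rmorph_nat).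
Qed.

Lemma row_crossing_lt (D : diagram) (i : 'I_(num_arcs D)) : (i./2 < size D)%N.
Proof. have := ltn_ord i; rewrite /num_arcs; lia. Qed.

Lemma sum_arc_delta (R : comNzRingType) (D : diagram) (y : nat -> R) (x : nat) :
  x \in arcs D -> \sum_(j < num_arcs D) (x == j.+1)%:R * y j.+1 = y x.
Proof.
rewrite mem_iota; case: x => // x /andP[_ xm]; rewrite add1n ltnS in xm.
rewrite (bigD1 (Ordinal xm)) //= eqxx mul1r big1 ?addr0 // => j jx.
rewrite eqSS (_ : (x == j) = false) ?mul0r //.
by apply/negbTE; apply: contraNneq jx => xj; apply/eqP/val_inj.
Qed.

Lemma relation_matrix_mul (R : comNzRingType) (u v : R) (D : diagram) (y : nat -> R)
    (i : 'I_(num_arcs D)) : knot_diagram D ->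
  (relation_matrix u v D *m \col_j y j.+1) i 0 =
  relation u v (odd i) (crossing_at D i./2) y.
Proof.
move=> DK; rewrite mxE; under eq_bigr do rewrite !mxE.
have [oi ui oo uo] := crossing_arcs DK (row_crossing_lt i).
rewrite /relation; case: (odd i); case: (positive _);
under eq_bigr do rewrite ?mulrDl ?mulNr -?mulrA;
by rewrite !(sumrB, big_split, sumrN) /= -?mulr_sumr !sum_arc_delta.
Qed.

Lemma sum_row_pairs (V : nmodType) (n : nat) (F : nat -> V) :
  \sum_(i < 2 * n) F i = \sum_(k < n) (F (2 * k)%N + F (2 * k).+1).
Proof.
elim: n => [|n IH]; first by rewrite !big_ord0.
by rewrite mulnS !big_ord_recr /= IH addrA.
Qed.

(** At u = 1 the first relation of every crossing, positive or negative, is the sum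
    of the incoming arcs minus the sum of the outgoing arcs.  Summed over the
    crossings this cancels, since every arc comes in once and goes out once. *)
Lemma det_relation_u1 (R : idomainType) (v : R) (D : diagram) : knot_diagram D ->
  \det (relation_matrix 1 v D) = 0.
Proof.
move=> DK; have Dm := num_arcs_gt0 DK.
pose y : 'rV[R]_(num_arcs D) := \row_i (~~ odd i)%:R.
apply: (@det_left_null _ _ _ y (Ordinal Dm)); last by rewrite mxE oner_eq0.
apply/matrixP => i j; rewrite !mxE.
under eq_bigr do rewrite !mxE.
rewrite (sum_row_pairs (size D) (fun r => (~~ odd r)%:R *
  relation 1 v (odd r) (crossing_at D r./2) (fun x : nat => (x == j.+1)%:R))).
pose F (x : nat) : R := (x == j.+1)%:R.
transitivity (\sum_(k < size D) (F (over_in (crossing_at D k)) + F (under_in (crossing_at D k)))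
  - \sum_(k < size D) (F (over_out (crossing_at D k)) + F (under_out (crossing_at D k)))).
  rewrite -sumrB; apply: eq_bigr => k _.
  rewrite mul2n /= odd_double mul0r mul1r addr0 doubleK /relation /F.
  by case: (positive _); ring.
by rewrite -(big_in_arcs _ F DK) -(big_out_arcs _ F DK) subrr.
Qed.

Lemma det_relation_v1 (R : idomainType) (u : R) (D : diagram) : knot_diagram D ->
  \det (relation_matrix u 1 D) = 0.
Proof.
move=> DK; have Dm := num_arcs_gt0 DK.
apply: (@det_right_null _ _ _ (\col_j 1) (Ordinal Dm)); last by rewrite mxE oner_eq0.
apply/matrixP => i j; rewrite ord1 (relation_matrix_mul _ _ (fun=> 1)) // mxE /relation.
by case: (odd i); case: (positive _); ring.
Qed.

(** If uv = 1, the relations of a crossing say that the over strand is multiplied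
    by u and the under strand by v at a positive crossing, and the other way round
    at a negative one.  The two factors cancel, so these rules define a nonzero
    solution along the knot. *)
Lemma det_relation_uv1 (R : idomainType) (u v : R) (D : diagram) : knot_diagram D ->
  u * v = 1 -> \det (relation_matrix u v D) = 0.
Proof.
move=> DK uv; pose w x := let c := crossing_at D (end_crossing D x) in
  if (x == over_in c) == positive c then u else v.
have wo k : (k < size D)%N ->
    w (over_in (crossing_at D k)) = if positive (crossing_at D k) then u else v.
  by move=> kD; rewrite /w end_over_in // eqxx; case: (positive _).
have wu k : (k < size D)%N ->
    w (under_in (crossing_at D k)) = if positive (crossing_at D k) then v else u.
  by move=> kD; rewrite /w end_under_in // over_neq_under //; case: (positive _).
have [|y [y1 yw]] := @knot_potential _ D w DK.
  rewrite (big_in_arcs _ w DK) big1 // => k _; rewrite /= wo // wu //.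
  by case: (positive _); rewrite // mulrC.
apply: (@det_right_null _ _ _ (\col_j y j.+1) (Ordinal (num_arcs_gt0 DK))).
  apply/matrixP => i j; rewrite ord1 relation_matrix_mul // mxE.
  have kD := row_crossing_lt i; have [oi ui oo uo] := crossing_arcs DK kD.
  have := yw _ oi; rewrite next_over_in // wo //.
  have := yw _ ui; rewrite next_under_in // wu // /relation.
  case: (odd i); case: (positive _) => e1 e2;
    rewrite ?e1 ?e2 ?[v * (u * _)]mulrA ?[u * (v * _)]mulrA ?[v * u]mulrC ?uv; ring.
by rewrite mxE y1 oner_eq0.
Qed.

(** * First-order expansion at u = v = -1 *)

(** The arc s of the crossing whose coefficient carries the parameter e = v + 1
    after the row operation of relation_row_op. *)
Definition perturbed_arc (c : crossing) : nat :=
  if positive c then over_out c else over_in c.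

(** The row of the passage that begins with arc x: the second relation of the
    crossing for the over strand, the first one for the under strand. *)
Definition row_of_arc (D : diagram) (x : nat) : nat :=
  let k := end_crossing D x in ((x == over_in (crossing_at D k)) + 2 * k)%N.

Lemma row_of_arc_lt (D : diagram) (x : nat) : knot_diagram D -> x \in arcs D ->
  (row_of_arc D x < num_arcs D)%N.
Proof.
move=> DK xD; have := end_crossing_lt DK xD.
by rewrite /row_of_arc /num_arcs; case: (_ == _); lia.
Qed.

Lemma row_of_arc_inj (D : diagram) : knot_diagram D ->
  {in arcs D &, injective (row_of_arc D)}.
Proof.
move=> DK x y xD yD; rewrite /row_of_arc => e.
have ek : end_crossing D x = end_crossing D y.
  by move: e; case: (_ == _); case: (_ == _); lia.
have eb : (x == over_in (crossing_at D (end_crossing D x))) =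
          (y == over_in (crossing_at D (end_crossing D y))).
  by move: e; case: (_ == _); case: (_ == _); lia.
by rewrite (arc_end_strand DK xD) (arc_end_strand DK yD) eb ek.
Qed.

(** The second relation of a crossing involves only its over strand.  At u = -1,
    subtracting it from the first relation at a positive crossing, or adding it at
    a negative one, leaves a relation that to order 0 in e involves only the under
    strand. *)
Lemma relation_row_op (R : comNzRingType) (e : R) (D : diagram) (x : nat) (y : nat -> R) :
  knot_diagram D -> x \in arcs D ->
  let c := crossing_at D (end_crossing D x) in
  let o := x == over_in c in
  relation (-1) (e - 1) o c y +
    (~~ o)%:R * ((-1) ^+ positive c * relation (-1) (e - 1) true c y) =
  (-1) ^+ (o || ~~ positive c) * (y x + y (next_arc D x) - e * y (perturbed_arc c)).
Proof.
move=> DK xD /=; have := arc_end_strand DK xD; rewrite /= /next_arc -/(crossing_at D _).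
set c := crossing_at D _; rewrite /relation /perturbed_arc.
by case: eqP => _ /(congr1 y) ->; case: (positive c) => /=; ring.
Qed.

(** The map phi sets e to 0, so that its value on d is the coefficient of e in the
    determinant. *)
Lemma det_relation_uN1 (R S : comNzRingType) (phi : {rmorphism R -> S}) (e : R)
    (D : diagram) : knot_diagram D -> phi e = 0 ->
  exists (d : R) (b : nat), \det (relation_matrix (-1) (e - 1) D) = e * d /\
    phi d = (-1) ^+ b * (2 * odd_writhe D)%:~R.
Proof.
move=> DK phie; set A := relation_matrix _ _ _; set m := num_arcs D.
have m0 : (0 < m)%N := num_arcs_gt0 DK.
(* Rows: clear the over strand from the first relation of every crossing. *)
pose t i : R := (-1) ^+ positive (crossing_at D i./2).
pose A' := pair_row_op m t *m A.
have A'E x (xD : x \in arcs D) (j : 'I_m) :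
  A' (Ordinal (row_of_arc_lt DK xD)) j =
  let c := crossing_at D (end_crossing D x) in
  (-1) ^+ ((x == over_in c) || ~~ positive c) *
  ((x == j.+1)%:R + (next_arc D x == j.+1)%:R - e * (perturbed_arc c == j.+1)%:R).
  rewrite /= -(relation_row_op _ (fun a => (a == j.+1)%:R)) //.
  pose rel (i : nat) :=
    relation (-1) (e - 1) (odd i) (crossing_at D i./2) (fun a => (a == j.+1)%:R : R).
  set o := x == _; set k := end_crossing D x.
  have rowE : row_of_arc D x = (o + 2 * k)%N by [].
  have row_odd : odd (row_of_arc D x) = o by rewrite rowE; case: (o); lia.
  have row_half : (row_of_arc D x)./2 = k by rewrite rowE; case: (o); lia.
  rewrite mxE (eq_bigr (fun i : 'I_m => rel i * (row_of_arc D x == i)%N%:R +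
    rel i * (~~ o && ((row_of_arc D x).+1 == i)%N)%:R * t (row_of_arc D x))); last first.
    move=> i _; rewrite !mxE -val_eqE /= row_odd /rel; ring.
  rewrite big_split /= (sum_delta (fun i : 'I_m => rel i) (row_of_arc_lt DK xD)) /= /rel.
  rewrite row_odd row_half; congr (_ + _).
  have := row_of_arc_lt DK xD; rewrite rowE -/m => rm.
  case o0: o rowE; first by rewrite mul0r big1 // => i _; rewrite mulr0 mul0r.
  move=> rowE; have rm' : ((0 + 2 * k).+1 < m)%N.
    by move: rm; rewrite o0 /m /num_arcs; lia.
  rewrite -mulr_suml /= (sum_delta (fun i : 'I_m => rel i) rm') /= /rel /t add0n.
  rewrite (_ : odd _ = true); last by lia.
  rewrite (_ : (2 * k).+1./2 = k)%N; last by lia.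
  rewrite (_ : (2 * k)./2 = k)%N; last by lia.
  by rewrite mul1r mulrC.
(* Reindex the rows and the columns by the positions along the knot. *)
pose xi (i : 'I_m) := arc_at_arcs DK (ltn_ord i).
pose f (i : 'I_m) : 'I_m := Ordinal (row_of_arc_lt DK (xi i)).
have arc_predK (i : 'I_m) : (arc_at D i).-1.+1 = arc_at D i.
  by have := xi i; rewrite mem_iota; case: (arc_at D i).
have gP (j : 'I_m) : ((arc_at D j).-1 < m)%N.
  by have := xi j; rewrite mem_iota -/m; lia.
pose g (j : 'I_m) : 'I_m := Ordinal (gP j).
have finj : injective f.
  move=> i j /(congr1 val) /= /(row_of_arc_inj DK (xi i) (xi j)) e1; apply: val_inj => /=.
  by rewrite -(arc_posK DK (ltn_ord i)) -(arc_posK DK (ltn_ord j)) e1.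
have ginj : injective g.
  move=> i j /(congr1 val) /= e1; apply: val_inj => /=.
  rewrite -(arc_posK DK (ltn_ord i)) -(arc_posK DK (ltn_ord j)).
  by rewrite -arc_predK e1 arc_predK.
pose c (i : 'I_m) := crossing_at D (end_crossing D (arc_at D i)).
(* The sign of row i combines (-1)^i with the sign of relation_row_op. *)
pose a (i : 'I_m) := (((arc_at D i == over_in (c i)) || ~~ positive (c i)) + i)%N.
have [r] := det_signed_reindex A' a (fun j : 'I_m => j : nat) finj ginj.
rewrite det_mulmx det_pair_row_op mul1r.
pose B : 'M[R]_m :=
  \matrix_(i, j) - ((-1) ^+ (i + j) * (perturbed_arc (c i) == arc_at D j)%:R).
have [|d [b [-> phid]]] := @det_cyclic_form R S phi m
  (\matrix_(i, j) ((-1) ^+ a i * (-1) ^+ j * A' (f i) (g j))) B e m0 phie.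
  move=> i j; rewrite mxE A'E [B _ _]mxE /= arc_predK -/(c i) next_arc_at.
  have eq_at (k l : nat) : (k < m)%N -> (l < m)%N ->
      (arc_at D k == arc_at D l) = (k == l).
    move=> km lm; apply/eqP/eqP => [ekl|-> //].
    by rewrite -(arc_posK DK km) -(arc_posK DK lm) ekl.
  have at_succ : (arc_at D i.+1 == arc_at D j) = (i.+1 %% m == j)%N.
    have : (i.+1 <= m)%N := ltn_ord i; rewrite leq_eqVlt => /orP[/eqP im|im].
      by rewrite im modnn arc_at_closed // -[1%N]/(arc_at D 0) eq_at.
    by rewrite modn_small // eq_at.
  rewrite at_succ eq_at // val_eqE /a -/(c i) !exprD.
  have sgn (k l : nat) (s : R) : ((-1) ^+ k = s * (-1) ^+ l) ->
      (-1) ^+ k * (-1) ^+ l = s.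
    by move=> ->; rewrite -mulrA -exprD -signr_odd addnn odd_double mulr1.
  set s := (-1) ^+ (_ || _).
  have ss : s * s = 1 by rewrite (sgn _ _ 1) ?mul1r.
  set q := (-1) ^+ i * (-1) ^+ j.
  have q0 : q * (i == j)%:R = (i == j)%:R.
    by case: eqVneq => [ij|]; rewrite ?mulr0 // /q (sgn _ _ 1) ?mulr1 // ij mul1r.
  have q1 : q * (i.+1 %% m == j)%N%:R = - (i.+1 %% m == j)%N%:R.
    case: (eqVneq (i.+1 %% m)%N (j : nat)) => [ij|]; last by rewrite mulr0 oppr0.
    rewrite /q (sgn _ _ (-1)) ?mulr1 // -ij mulN1r.
    rewrite -[in LHS]signr_odd -[in RHS]signr_odd.
    have : (i.+1 <= m)%N := ltn_ord i; rewrite leq_eqVlt => /orP[/eqP im|im].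
      rewrite im modnn (_ : odd i = true) ?opprK //.
      by move: im; rewrite /m /num_arcs; lia.
    by rewrite modn_small //=; case: (odd i); rewrite /= ?opprK.
  set P := (i == j)%:R in q0 *; set Y := (_ == _)%:R in q1 *; set T := (_ == _)%:R.
  transitivity (s * s * (q * P + q * Y - e * (q * T))); first by rewrite /q; ring.
  by rewrite ss q0 q1; ring.
move=> Ad; exists ((-1) ^+ r * d), (r + b)%N; split.
  by rewrite mulrCA Ad mulrA -exprD -signr_odd addnn odd_double mul1r.
rewrite rmorphM rmorphXn rmorphN1 phid exprD -mulrA; congr (_ * (_ * _)).
rewrite -(rmorph_int phi); congr (phi _).
(* The entries of B, one in each row, are collected crossing by crossing. *)
pose F (x : nat) : R :=
  - ((-1) ^+ arc_pos D x * (-1) ^+ arc_pos D (perturbed_arc (crossing_at D (end_crossing D x)))).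
transitivity (\sum_(i < m) F (arc_at D i)).
  apply: eq_bigr => i _; under eq_bigr do rewrite mxE.
  have kD := end_crossing_lt DK (xi i).
  have [oi ui oo uo] := crossing_arcs DK kD.
  have twD : perturbed_arc (c i) \in arcs D by rewrite /perturbed_arc; case: (positive _).
  rewrite sumrN /F arc_posK // -/(c i); congr (- _).
  rewrite -(sum_delta (fun j : 'I_m => (-1) ^+ i * (-1) ^+ j) (arc_pos_lt DK twD)).
  apply: eq_bigr => j _; rewrite exprD; congr (_ * (nat_of_bool _)%:R).
  by apply/eqP/eqP => [->|<-]; rewrite ?arc_posK ?arc_atK.
rewrite -(big_arcs_at _ F DK) (big_in_arcs _ F DK) /odd_writhe.
rewrite mulr_sumr rmorph_sum [RHS]big_mkcond; apply: eq_bigr => k _ /=.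
have kD := ltn_ord k; have [oi ui oo uo] := crossing_arcs DK kD.
rewrite /F end_over_in // end_under_in // odd_return_length // /perturbed_arc -/(crossing_at D k).
have := sign_next_arc R DK oi; rewrite next_over_in // => soo.
set p := arc_pos D (over_in _); set q := arc_pos D (under_in _).
rewrite oddD; case: (positive _);
  rewrite ?soo -/p -[(-1) ^+ p]signr_odd -[(-1) ^+ q]signr_odd;
  case: (odd p); case: (odd q); rewrite /=; ring.
Qed.

(** * Division by (u - 1)(v - 1)(uv - 1) *)

Definition at_u (a : {poly int}) : {rmorphism Zuv -> {poly int}} := horner_eval a.

Definition at_v1 : {rmorphism Zuv -> {poly int}} := map_poly (horner_eval (1 : int)).

(** The curve uv = 1, with v as parameter. *)
Definition at_uv1 : {rmorphism Zuv -> {fraction {poly int}}} :=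
  horner_eval (tofrac ('X : {poly int}))^-1 \o map_poly (@tofrac {poly int}).

Lemma at_uU a : at_u a U = a. Proof. by rewrite /= /horner_eval hornerX. Qed.

Lemma at_uV a : at_u a V = 'X. Proof. by rewrite /= /horner_eval hornerC. Qed.

Lemma at_v1U : at_v1 U = 'X. Proof. by rewrite /= map_polyX. Qed.

Lemma at_v1V : at_v1 V = 1.
Proof. by rewrite /= map_polyC /= /horner_eval hornerX. Qed.

Lemma at_uv1U : at_uv1 U = (tofrac 'X)^-1.
Proof. by rewrite /= map_polyX /horner_eval hornerX. Qed.

Lemma at_uv1C c : at_uv1 c%:P = tofrac c.
Proof. by rewrite /= map_polyC /horner_eval hornerC. Qed.

Lemma at_uv1UV : at_uv1 (U * V) = 1.
Proof. by rewrite rmorphM at_uv1U at_uv1C mulVf // tofrac_eq0 polyX_eq0. Qed.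

(** The polynomial uv - 1 is not monic in u, so dividing by it costs a power of its
    leading coefficient v; this is harmless, as v is a unit among Laurent
    polynomials. *)
Lemma uv_factor (p : Zuv) : at_u 1 p = 0 -> at_v1 p = 0 -> at_uv1 p = 0 ->
  exists (q : Zuv) (k : nat), V ^+ k * p = q * ((U - 1) * (V - 1) * (U * V - 1)).
Proof.
move=> pu pv puv.
have /factor_theorem[p1 p1E] : root p 1 by apply/eqP.
have U1 : 'X - 1%:P = U - 1 by [].
rewrite {}U1 in p1E; move: pv puv; rewrite {}p1E {pu} !rmorphM !rmorphB !rmorph1.
rewrite at_v1U at_uv1U => /eqP; rewrite mulf_eq0 polyXsubC_eq0 orbF => /eqP p1v.
have X0 : tofrac ('X : {poly int}) != 0 by rewrite tofrac_eq0 polyX_eq0.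
have U10 : (tofrac ('X : {poly int}))^-1 - 1 != 0.
  rewrite subr_eq0 invr_eq1 -tofrac1 tofrac_eq -subr_eq0.
  exact: (monic_neq0 (monicXsubC 1)).
move=> /eqP; rewrite mulf_eq0 (negbTE U10) orbF => /eqP p1uv.
(* Exchanging the variables turns divisibility by v - 1 into a root. *)
have /factor_theorem[p2 p2E] : root (swapXY p1) (1%:P).
  by rewrite /root horner_swapXY; apply/eqP.
have {}p2E : p1 = swapXY p2 * (V - 1).
  rewrite -[LHS]swapXYK p2E rmorphM rmorphB /= swapXY_X swapXY_polyC.
  by rewrite map_polyC.
have V10 : at_uv1 (V - 1) != 0.
  by rewrite -[1]/(1%:P) -polyCB at_uv1C tofrac_eq0 (monic_neq0 (monicXsubC 1)).
move: p1uv; rewrite {p1v}p2E rmorphM => /eqP.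
rewrite mulf_eq0 (negbTE V10) orbF.
move: (swapXY p2) => p3 /eqP p3uv; have {}p3uv : at_uv1 p3 = 0 := p3uv.
set g := U * V - 1.
have gE : g = V * 'X + (-1)%:P by rewrite /g mulrC polyCN.
have g2 : size g = 2%N by rewrite gE size_MXaddC polyC_eq0 polyX_eq0 size_polyC polyX_eq0.
have gl : lead_coef g = 'X.
  rewrite gE lead_coefDl ?lead_coefMX ?lead_coefC // size_mulX ?polyC_eq0 ?polyX_eq0 //.
  by rewrite !size_polyC polyX_eq0 oppr_eq0 oner_eq0.
have := Pdiv.Idomain.divp_eq p3 g.
have := ltn_modp p3 g; rewrite -size_poly_gt0 g2 /= ltnS => /size1_polyC.
move: (p3 %% g) (p3 %/ g) (scalp _ _) => r q k rC.
rewrite gl rC -mul_polyC polyC_exp -/V => e.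
have {}e : V ^+ k * p3 = q * g.
  (* The remainder is constant in u and vanishes on the curve uv = 1. *)
  suff r0 : r`_0 = 0 by rewrite e r0 addr0.
  apply/eqP; rewrite -tofrac_eq0 -at_uv1C -(addKr (q * g) _%:P) -e.
  by rewrite rmorphD rmorphN !rmorphM p3uv rmorphB at_uv1UV rmorph1 subrr !mulr0 oppr0 addr0.
exists q, k; rewrite -!mulrA (mulrA _ p3) e /g; ring.
Qed.

Lemma denominator_neq0 : (U - 1) * (V - 1) * (U * V - 1) != 0.
Proof.
have V1 : V - 1 = ('X - 1%:P)%:P by rewrite polyCB.
rewrite !mulf_neq0 ?(monic_neq0 (monicXsubC 1)) // ?V1 ?polyC_eq0;
  rewrite ?(monic_neq0 (monicXsubC 1)) //.
apply/eqP => /(congr1 (at_u 0)); rewrite rmorphB rmorphM at_uU.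
rewrite mul0r sub0r rmorph1 rmorph0 => /eqP.
by rewrite oppr_eq0 oner_eq0.
Qed.

(** * The normalized invariant *)

(** The leading coefficient of the leading coefficient occurs among the listed
    coefficients, so the search for a nonzero one succeeds. *)
Lemma lowest_coef_neq0 (p : Zuv) : p != 0 -> lowest_coef p != 0.
Proof.
move=> p0; rewrite /lowest_coef; apply: (nth_find 0 (a := fun c => c != 0)).
apply/hasP; set i := (size p).-1; set j := (size p`_i).-1.
have pi0 : p`_i != 0 by rewrite -[p`_i]/(lead_coef p) lead_coef_eq0.
exists (p`_i`_j); last by rewrite -[_`_j]/(lead_coef p`_i) lead_coef_eq0.
have ip : (i < size p)%N by rewrite /i prednK ?size_poly_gt0.
have jp : (j < size (p`_i)%R)%N by rewrite /j prednK ?size_poly_gt0.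
have jmax : (size (p`_i)%R <= \max_(i < size p) size (p`_i)%R)%N.
  exact: (leq_bigmax (F := fun i : 'I_(size p) => size p`_i) (Ordinal ip)).
apply/flattenP; exists [seq p`_l`_(i + j - l) | l <- iota 0 (i + j).+1].
  apply: (map_f (fun d => [seq p`_l`_(d - l) | l <- iota 0 d.+1])).
  by rewrite mem_iota; lia.
by apply/mapP; exists i; rewrite ?mem_iota ?addKn //; lia.
Qed.

Lemma normalized_quotient (F : fieldType) (s q u v P : F) (k l : nat) :
  u != 0 -> v != 0 -> P != 0 ->
  s * (u * v) ^- l * (q * P / v ^+ k) / P = s * (q * u ^+ k) / (u * v) ^+ (k + l).
Proof.
move=> u0 v0 P0; rewrite !exprD !exprMn; field.
by rewrite P0 !expf_neq0.
Qed.

(* D is any diagram of a virtual knot represented by VT(a_1, ..., a_n). *)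
Theorem corollary2 (a : seq int) (D : diagram) (a_nonempty : (0 < size a)%N)
    (D_knot : knot_diagram D) (D_twist : same_virtual_knot D (VT a)) :
  exists z : int,
    laurent_value (Delta0bar D) (-1) (-1) z /\ 2 * `|z| = `|odd_writhe D|.
Proof.
have [|||q [k qE]] := @uv_factor (alexander_det D).
- by rewrite alexander_det_eval at_uU det_relation_u1.
- by rewrite alexander_det_eval at_v1V det_relation_v1.
- by rewrite alexander_det_eval det_relation_uv1 // -rmorphM at_uv1UV.
have [|d [b [detE dE]]] := @det_relation_uN1 _ _ (horner_eval (-1 : int)) ('X + 1) D D_knot.
  by rewrite /= /horner_eval !hornerE addNr.
(* On the line u = -1, with e = v + 1, both sides of qE are divisible by e. *)
have q_value : `|eval_uv q (-1) (-1)| * 2 = `|odd_writhe D|.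
  have := congr1 (at_u (-1)) qE.
  rewrite !rmorphM rmorphXn !rmorphB rmorphM rmorph1 alexander_det_eval !at_uU at_uV.
  rewrite -{2}['X](addrK 1) detE => e.
  have {}e : 'X ^+ k * d = (at_u (-1) q) * (2 * ('X - 1)).
    have X1 : 'X + 1 != 0 :> {poly int}.
      by rewrite -[X in 'X + X]opprK -polyC1 -polyCN monic_neq0 ?monicXsubC.
    apply: (mulfI X1); rewrite mulrCA e; ring.
  have {}e : (-1) ^+ k * d.[-1] = eval_uv q (-1) (-1) * (- 4).
    have := congr1 (horner_eval (-1)) e.
    rewrite /eval_uv polyCN polyC1 /= /horner_eval !hornerE => ->.
    by rewrite -[LHS]mulrA; congr (_ * _).
  move: dE; rewrite /= /horner_eval => dE.
  have := congr1 Num.norm e; rewrite dE !normrM !normrX !normrN1 !expr1n !mul1r.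
  rewrite intz normrM normrN; lia.
move: denominator_neq0 qE; move PE: (_ * (U * V - 1)) => P P0 qE.
set p := alexander_det D in qE *; set l := lowest_u p.
(* At (-1, -1) the monomial v^k contributes (-1)^k and uv contributes 1. *)
set s := sgz (lowest_coef p).
exists (s * (eval_uv q (-1) (-1) * (-1) ^+ k)); split.
  exists (s%:~R * (q * U ^+ k)), (k + l)%N; split.
    rewrite /Delta0bar /Delta0 -/p -/l -/s PE.
    have V0 : tofrac V != 0 by rewrite tofrac_eq0 polyC_eq0 polyX_eq0.
    have U0 : tofrac U != 0 by rewrite tofrac_eq0 polyX_eq0.
    have P0' : tofrac P != 0 by rewrite tofrac_eq0.
    have pE : tofrac p = tofrac q * tofrac P / tofrac V ^+ k.
      by apply: (canRL (mulfK (expf_neq0 k V0))); rewrite -tofracXn -!tofracM -qE mulrC.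
    rewrite pE !tofracM tofracXn rmorph_int.
    exact: (@normalized_quotient Quv _ _ _ _ _ _ _ U0 V0 P0').
  rewrite !eval_uvM mulrNN mulr1 expr1n mulr1; congr (_ * (_ * _)).
    by rewrite /eval_uv -(rmorph_int polyC) hornerC -(rmorph_int polyC) hornerC intz.
  by rewrite /eval_uv horner_exp hornerX -polyC_exp hornerC.
rewrite !normrM normrX normrN1 expr1n mulr1 -q_value.
have [p0|p0] := eqVneq p 0.
  (* Here the sign s is 0, but so is q, hence the odd writhe. *)
  suff -> : q = 0 by rewrite /eval_uv !horner0 normr0 !mulr0 mul0r.
  by move/eqP: qE; rewrite p0 mulr0 eq_sym mulf_eq0 (negbTE P0) orbF => /eqP.
by rewrite /s normr_sgz lowest_coef_neq0 // mul1r mulrC.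
Qed.
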